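(* Let $k$ be a positive integer and let $H$ be a $3$-regular graph. Let $G$ be the graph obtained from the disjoint union of $\Xi_{2k+1}$ and $H$ by adding an edge between a vertex of degree $2$ in $\Xi_{2k+1}$ and an arbitrary vertex of $H$. If $$\frac{M_1(G)}{n(G)}>\frac{M_2(G)}{m(G)},$$ then $n(G)\geq 218$.
   Context: All graphs are finite, simple, non-null and have no isolated vertices (except for the auxiliary edgeless graphs $H_i$ used below); $H$ need not be connected. For a graph $G$ with vertex set $V(G)$ and edge set $E(G)$: $n(G)=|V(G)|$ is the order, $m(G)=|E(G)|$ is the size, and $d_G(u)$ is the degree of a vertex $u$. The first and second Zagreb indices are $M_1(G)=\sum_{v\in V(G)}d_G(v)^2$ and $M_2(G)=\sum_{uv\in E(G)}d_G(u)d_G(v)$. Definition of $\Xi_{2k+1}$ for an integer $k\geq 1$: let $P_{2k+1}=v_1v_2\ldots v_{2k+1}$ and $Q_{2k+1}=u_1u_2\ldots u_{2k+1}$ be two disjoint paths, each on $2k+1$ vertices. For each odd $i$ with $3\leq i\leq 2k-1$, let $H_i$ be the edgeless graph on three new vertices $i_1,i_2,i_3$; for $i\in\{1,2k+1\}$, let $H_i$ be the edgeless graph on four new vertices $i_1,i_2,i_3,i_4$ (all these vertices are distinct and disjoint from the paths). Then $\Xi_{2k+1}$ has vertex set $V(P_{2k+1})\cup V(Q_{2k+1})\cup V(H_1)\cup V(H_3)\cup\cdots\cup V(H_{2k+1})$ and edge set $$E(P_{2k+1})\cup E(Q_{2k+1})\cup\bigcup_{l\in\{3,5,\ldots,2k-1\}}\{v_l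 l_j,\ u_l l_j: 1\leq j\leq 3\}\cup\{v_i i_j,\ u_i i_j: i\in\{1,2k+1\},\ 1\leq j\leq 4\}.$$ *)

(* Defs.v *)
From HB Require Import structures.
From mathcomp Require Import all_boot all_order all_algebra.

Set Implicit Arguments.
Unset Strict Implicit.
Unset Printing Implicit Defensive.

Record sgraph := SGraph {
  vert :> finType;
  adj : rel vert;
  adj_sym : symmetric adj;
  adj_irr : irreflexive adj
}.

Section Invariants.
Variable G : sgraph.

Definition deg (v : G) : nat := #|[set w | adj v w]|.

Definition edges : {set {set G}} :=
  [set E | [exists u, exists v, adj u v && (E == [set u; v])]].

Definition gorder : nat := #|G|.
Definition gsize : nat := #|edges|.

Definition M1 : nat := \sum_(v : G) deg v ^ 2.

(* An edge is a set of exactly two vertices u, v (adj is irreflexive), so the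
   inner product is deg u * deg v. *)
Definition M2 : nat := \sum_(E in edges) \prod_(v in E) deg v.

Definition regular (r : nat) : Prop := forall v : G, deg v = r.

End Invariants.

Section JoinByEdge.
Variables (G H : sgraph) (u : G) (w : H).

Definition join_adj (x y : G + H) : bool :=
  match x, y with
  | inl a, inl b => adj a b
  | inr a, inr b => adj a b
  | inl a, inr b => (a == u) && (b == w)
  | inr b, inl a => (a == u) && (b == w)
  end.

Lemma join_adj_sym : symmetric join_adj.
Proof. by move=> [a|a] [b|b] //=; rewrite adj_sym. Qed.

Lemma join_adj_irr : irreflexive join_adj.
Proof. by move=> [a|a] /=; rewrite adj_irr. Qed.

(* The disjoint union of G and H together with the edge uw. *)
Definition join_by_edge : sgraph := SGraph join_adj_sym join_adj_irr.

End JoinByEdge.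

Section Xi.
Variable k : nat.

(* The edgeless graphs H_1, H_3, ..., H_(2k+1) are indexed by l <= k, the index
   l standing for H_(2l+1); hsize l is the number of vertices of H_(2l+1). *)
Definition hsize (l : 'I_k.+1) : nat :=
  if (l == 0 :> nat) || (l == k :> nat) then 4 else 3.

(* Path positions are counted from 0: inl (false, i) is v_(i+1) and
   inl (true, i) is u_(i+1). The vertex inr (Tagged _ j), with tag l and
   j : 'I_(hsize l), is the (j+1)-st vertex of H_(2l+1). *)
Definition xi_vert : finType :=
  ((bool * 'I_(2 * k).+1) + {l : 'I_k.+1 & 'I_(hsize l)})%type.

(* The path vertices joined to H_(2l+1) are v_(2l+1) and u_(2l+1), which are at
   position 2l. *)
Definition xi_adj (x y : xi_vert) : bool :=
  match x, y with
  | inl (b, i), inl (c, j) =>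
      (b == c) && ((i.+1 == j :> nat) || (j.+1 == i :> nat))
  | inl (_, i), inr h => i == 2 * tag h :> nat
  | inr h, inl (_, i) => i == 2 * tag h :> nat
  | inr _, inr _ => false
  end.

Lemma xi_adj_sym : symmetric xi_adj.
Proof. by move=> [[b i]|h] [[c j]|h'] //=; rewrite eq_sym orbC. Qed.

Lemma xi_adj_irr : irreflexive xi_adj.
Proof.
move=> [[b i]|h] //=; rewrite orbb.
by have /negbTE-> : i.+1 != i :> nat; [rewrite gtn_eqF | rewrite andbF].
Qed.

(* The graph Xi_(2k+1). *)
Definition Xi : sgraph := SGraph xi_adj_sym xi_adj_irr.

End Xi.

(* Main.v *)
Require Import Defs.
From mathcomp Require Import all_boot all_order all_algebra.
From mathcomp Require Import zify.

(* Every edge of Xi_(2k+1) joins a vertex of degree 5 to a vertex of degree 2,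
   and H is cubic, so with K = k + 1, n = n(H) and m = m(H) the joined graph has
   order 7K + n, size 10K + m + 1, M_1 = 70K + 9n + 12 and M_2 = 100K + 9m + 31.
   Since 2m = 3n, the hypothesis becomes (K - 8)(n - 54) > 408.  Negative factors
   are impossible as then the product is at most 7 * 54, and for positive ones
   AM-GM bounds 7(K - 8) + (n - 54) from below by 108, that is, the order by
   56 + 54 + 108 = 218. *)

Set Implicit Arguments.
Unset Strict Implicit.
Unset Printing Implicit Defensive.

(** * Sums of indicators and sums over parity classes *)

Lemma sum_indicator (T : finType) (a : T) (f : T -> nat) :
  \sum_x (x == a) * f x = f a.
Proof.
rewrite (bigD1 a) //= eqxx mul1n big1 ?addn0 // => x /negbTE ->.
by rewrite mul0n.
Qed.

Lemma sum_eq1 (T : finType) (a : T) : \sum_x (x == a) = 1.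
Proof.
by rewrite -[RHS](sum_indicator a (fun=> 1)); apply: eq_bigr => x _; rewrite muln1.
Qed.

Lemma sum_pair (I J : finType) (f : I * J -> nat) :
  \sum_p f p = \sum_i \sum_j f (i, j).
Proof. by rewrite pair_bigA; apply: eq_bigr => -[]. Qed.

Lemma sum_odd (a b n : nat) :
  \sum_(i < (2 * n).+1) (if odd i then a else b) = a * n + b * n.+1.
Proof.
elim: n => [|n IHn]; first by rewrite big_ord1 /=; lia.
have -> : (2 * n.+1).+1 = (2 * n).+3 by lia.
rewrite 2!big_ord_recr /= IHn oddM /=; lia.
Qed.

(** * Edge sums as sums over ordered adjacent pairs *)

Section DoubleCounting.
Variable G : sgraph.

Lemma degE (v : G) : deg v = \sum_w adj v w.
Proof.
rewrite /deg -sum1_card big_mkcond; apply: eq_bigr => w _.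
by rewrite inE; case: adj.
Qed.

Lemma eq_set2 (x y u v : G) : x != y ->
  ([set x; y] == [set u; v]) = ((x, y) == (u, v)) || ((x, y) == (v, u)).
Proof.
move=> neq; apply/eqP/orP => [E|[] /eqP [-> ->] //]; last by rewrite setUC.
have := set21 x y; have := set22 x y; rewrite E !inE !xpair_eqE.
by move=> /orP [] /eqP yE /orP [] /eqP xE; move: neq;
  rewrite xE yE !eqxx /=; auto.
Qed.

(** Group the ordered adjacent pairs by their underlying set: the fibre over an edge is [(u, v)] and
    [(v, u)], two distinct pairs with the same product. *)
Lemma sum_edges (f : G -> nat) :
  2 * (\sum_(E in edges G) \prod_(v in E) f v) =
  \sum_x \sum_y adj x y * (f x * f y).
Proof.
transitivity (\sum_(p : G * G | adj p.1 p.2) f p.1 * f p.2); last first.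
  rewrite pair_big big_mkcond; apply: eq_bigr => p _ /=.
  by case: adj; rewrite ?mul1n.
rewrite (partition_big (fun p : G * G => [set p.1; p.2]) (mem (edges G))) /=;
  last first.
  by move=> [x y] /= xy; rewrite inE; apply/existsP; exists x;
    apply/existsP; exists y; rewrite xy eqxx.
rewrite big_distrr; apply: eq_bigr => E.
rewrite inE => /existsP [u /existsP [v /andP [uv /eqP ->]]].
have neq_uv : u != v by apply: contraTneq uv => ->; rewrite adj_irr.
rewrite (bigD1 (u, v)) /= ?uv ?eqxx // (bigD1 (v, u)) /=; last first.
  by rewrite adj_sym uv setUC eqxx xpair_eqE (negbTE neq_uv) andbF.
rewrite [X in _ + (_ + X)]big_pred0; last first.
  move=> [x y] /=.
  case xy: (adj x y) => //=.
  have neq_xy : x != y by apply: contraTneq xy => ->; rewrite adj_irr.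
  by rewrite eq_set2 //; case: eqP; case: eqP.
rewrite big_setU1 /= ?inE // big_set1; lia.
Qed.

Lemma handshake : 2 * gsize G = \sum_(v : G) deg v.
Proof.
have -> : gsize G = \sum_(E in edges G) \prod_(v in E) 1.
  by rewrite /gsize -sum1_card; apply: eq_bigr => E _; rewrite big1.
rewrite sum_edges; apply: eq_bigr => v _; rewrite degE.
by apply: eq_bigr => w _; rewrite !muln1.
Qed.

Lemma M2_double : 2 * M2 G = \sum_(x : G) \sum_y adj x y * (deg x * deg y).
Proof. exact: sum_edges. Qed.

(** After doubling, both sides are sums over ordered adjacent pairs, by [M2_double] and [handshake],
    and they agree term by term. *)
Lemma M2_const_edges c :
  (forall x y : G, adj x y -> deg x * deg y = c) -> M2 G = c * gsize G.
Proof.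
move=> adjc; apply/eqP; rewrite -(eqn_pmul2l (isT : 0 < 2)) mulnCA handshake.
apply/eqP; rewrite M2_double big_distrr; apply: eq_bigr => x _.
rewrite degE big_distrr; apply: eq_bigr => y _ /=.
by rewrite -degE; case xy: (adj x y); rewrite ?muln0 // adjc // mul1n muln1.
Qed.

End DoubleCounting.

(** * Invariants of two graphs joined by an edge *)

Section Join.
Variables (G H : sgraph) (u : G) (w : H).
Let J := join_by_edge u w.

Lemma deg_join_l (a : G) : deg (inl a : J) = deg a + (a == u).
Proof.
rewrite !degE big_sumType /=; congr (_ + _).
by case: (a == u) => /=; [exact: sum_eq1 | rewrite big1].
Qed.

Lemma deg_join_r (b : H) : deg (inr b : J) = deg b + (b == w).
Proof.
rewrite !degE big_sumType /= addnC; congr (_ + _).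
case: (b == w) => /=; last by rewrite big1 // => a _; rewrite andbF.
by rewrite (eq_bigr (fun a => nat_of_bool (a == u))) ?sum_eq1 // => a _; rewrite andbT.
Qed.

Lemma gorder_join : gorder J = gorder G + gorder H.
Proof. exact: card_sum. Qed.

Lemma gsize_join : gsize J = gsize G + gsize H + 1.
Proof.
have := handshake J; rewrite big_sumType /=.
under eq_bigr do rewrite deg_join_l.
under [X in _ + X]eq_bigr do rewrite deg_join_r.
by rewrite !big_split /= !sum_eq1 -!handshake; lia.
Qed.

Lemma sum_sq_bump (K : sgraph) (a : K) :
  \sum_(v : K) (deg v + (v == a)) ^ 2 = M1 K + (2 * deg a + 1).
Proof.
rewrite /M1 -(sum_indicator a (fun v => 2 * deg v + 1)) -big_split /=.
by apply: eq_bigr => v _; case: (v == a) => /=; lia.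
Qed.

Lemma M1_join : M1 J = M1 G + M1 H + 2 * (deg u + deg w + 1).
Proof.
rewrite {1}/M1 big_sumType /=.
under eq_bigr do rewrite deg_join_l.
under [X in _ + X]eq_bigr do rewrite deg_join_r.
rewrite !sum_sq_bump; lia.
Qed.

(** Expand the product. The two mixed terms are equal by symmetry of [adj]; the product of both
    indicators is nonzero only at [x = y = a], where [adj] vanishes. *)
Lemma sum_adj_bump (K : sgraph) (a : K) :
  \sum_x \sum_y adj x y * ((deg x + (x == a)) * (deg y + (y == a))) =
  2 * M2 K + 2 * \sum_y adj a y * deg y.
Proof.
rewrite M2_double.
transitivity (\sum_(x : K) \sum_y (adj x y * (deg x * deg y)
    + ((x == a) * (adj x y * deg y) + (y == a) * (adj x y * deg x)))).
  apply: eq_bigr => x _; apply: eq_bigr => y _.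
  have := adj_irr x; case: (x =P a) => [xa|_]; case: (y =P a) => [ya|_] /=;
    try by case: (adj x y); nia.
  by rewrite ya xa => ->.
under eq_bigr do rewrite big_split big_split /=.
rewrite !big_split /= mul2n -addnn; congr (_ + (_ + _)).
  under eq_bigr do rewrite -big_distrr /=.
  by rewrite sum_indicator.
under eq_bigr do rewrite sum_indicator.
by apply: eq_bigr => x _; rewrite adj_sym.
Qed.

Lemma sum_indicator2 (f : G -> nat) (g : H -> nat) :
  \sum_a \sum_b ((a == u) && (b == w)) * (f a * g b) = f u * g w.
Proof.
rewrite -(sum_indicator u f) -(sum_indicator w g) big_distrl /=.
apply: eq_bigr => a _; rewrite big_distrr /=.
by apply: eq_bigr => b _; rewrite -mulnb; lia.
Qed.

(** The neighbour sums record that an old edge at [u] or [w] gains the degree of its other end; the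
    last product is the new edge. Ordered pairs split into four blocks, the two mixed ones each
    holding the new edge once. *)
Lemma M2_join : M2 J = M2 G + M2 H
  + \sum_y adj u y * deg y + \sum_y adj w y * deg y + (deg u + 1) * (deg w + 1).
Proof.
have := M2_double J; rewrite big_sumType /=.
under eq_bigr do rewrite big_sumType /=.
under [X in _ + X]eq_bigr do rewrite big_sumType /=.
(* The block from [H] to [G] is transposed so that both mixed blocks fit [sum_indicator2]. *)
rewrite !big_split /= [X in _ + (X + _)]exchange_big /=.
under eq_bigr do under eq_bigr do rewrite !deg_join_l.
under [X in _ + X + _]eq_bigr do
  under eq_bigr do rewrite deg_join_l deg_join_r.
under [X in _ + (X + _)]eq_bigr do
  under eq_bigr do rewrite deg_join_l deg_join_r [(deg _ + _) * _]mulnC.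
under [X in _ + (_ + X)]eq_bigr do under eq_bigr do rewrite !deg_join_r.
rewrite !sum_adj_bump.
rewrite !(sum_indicator2 (fun a => deg a + (a == u)) (fun b => deg b + (b == w))).
rewrite !eqxx; lia.
Qed.

End Join.

(** * Degrees and invariants of [Xi k] *)

Section XiInvariants.
Variable k : nat.
Hypothesis k_gt0 : 0 < k.

Lemma sum_tagged (f : 'I_k.+1 -> nat) :
  \sum_(h : {l : 'I_k.+1 & 'I_(hsize l)}) f (tag h) = \sum_l hsize l * f l.
Proof.
rewrite -(@sig_big_dep _ _ addn _ (fun l => 'I_(hsize l)) predT (fun _ => predT)
  (fun l _ => f l)) /=.
by apply: eq_bigr => l _; rewrite sum_nat_const card_ord.
Qed.

(** Odd positions have only their two path neighbours. At even positions, an inner vertex has 2 + 3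
    neighbours and an end has 1 + 4, the larger [hsize] making up for the missing path neighbour. *)
Lemma deg_path (b : bool) (i : 'I_(2 * k).+1) :
  deg (inl (b, i) : Xi k) = if odd i then 2 else 5.
Proof.
have path_nbrs : \sum_(j < (2 * k).+1) ((i.+1 == j) || (j.+1 == i)) =
    (i < 2 * k) + (0 < i).
  transitivity (\sum_(j < (2 * k).+1) ((i.+1 == j) + (j.+1 == i))).
    by apply: eq_bigr => j _; lia.
  rewrite big_split /=; congr (_ + _).
    case: ltnP => lt_i; last by rewrite big1 // => j _; have := ltn_ord j; lia.
    have lt' : i.+1 < (2 * k).+1 by [].
    rewrite -[RHS](sum_eq1 (Ordinal lt')).
    by apply: eq_bigr => j _; rewrite eq_sym.
  case: ltnP => i_gt0; last by rewrite big1 // => j _; lia.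
  have lt' : i.-1 < (2 * k).+1 by have := ltn_ord i; lia.
  rewrite -[RHS](sum_eq1 (Ordinal lt')).
  by apply: eq_bigr => j _; rewrite -val_eqE /=; lia.
rewrite degE big_sumType /= (sum_tagged (fun l => nat_of_bool (i == 2 * l :> nat))).
rewrite sum_pair big_bool.
have -> (n : nat) : \sum_(j < (2 * k).+1) (b == true) && ((i.+1 == j) || (j.+1 == i))
    + \sum_(j < (2 * k).+1) (b == false) && ((i.+1 == j) || (j.+1 == i)) + n
    = (i < 2 * k) + (0 < i) + n.
  by case: (b); rewrite /= path_nbrs big1_eq ?addn0.
have lt_i := ltn_ord i.
case: ifP => odd_i.
  rewrite big1 => [|l _]; last by case: eqP => [|_]; lia.
  lia.
(* For even [i], the only [l] with [i = 2 * l] is [i./2]. *)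
have lt_half : i./2 < k.+1 by lia.
transitivity ((i < 2 * k) + (0 < i) + hsize (Ordinal lt_half)).
  congr (_ + _); rewrite -(sum_indicator (Ordinal lt_half) (@hsize k)).
  by apply: eq_bigr => l _; rewrite mulnC -val_eqE /=; congr (nat_of_bool _ * _); lia.
rewrite /hsize /=; case: ifP; lia.
Qed.

Lemma deg_H (h : {l : 'I_k.+1 & 'I_(hsize l)}) : deg (inr h : Xi k) = 2.
Proof.
rewrite degE big_sumType /= [X in _ + X]big1 // addn0.
rewrite sum_pair.
have lt2 : 2 * tag h < (2 * k).+1 by have := ltn_ord (tag h); lia.
by rewrite sum_nat_const card_bool (sum_eq1 (Ordinal lt2)).
Qed.

Lemma deg_adj (x y : Xi k) : adj x y -> deg x * deg y = 10.
Proof.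
case: x y => [[b i]|h] [[c j]|h'] //=.
- move=> /andP [_ ij]; rewrite !deg_path; case: ifP; case: ifP; lia.
- move=> ih; rewrite deg_path deg_H; case: ifP; lia.
- move=> ih; rewrite deg_path deg_H; case: ifP; lia.
Qed.

(** Three vertices for each of the [k + 1] indices, plus one more at each of 0 and [k], which differ
    because [k] is positive. *)
Lemma sum_hsize : \sum_(l < k.+1) hsize l = 3 * k + 5.
Proof.
transitivity (\sum_(l < k.+1) (3 + ((l == ord0) * 1 + (l == ord_max) * 1))).
  apply: eq_bigr => l _; rewrite /hsize -!val_eqE /=; case: ifP; lia.
rewrite !big_split /= (sum_indicator ord0 (fun=> 1)).
rewrite (sum_indicator ord_max (fun=> 1)) sum_nat_const card_ord; lia.
Qed.

(** Degree 2 occurs [2 * k] times on the paths and [3 * k + 5] times off them; degree 5 occurs at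
    the [k + 1] even positions of each path. Constant, identity and square [g] give the order, twice
    the size and [M1]. *)
Lemma sum_Xi (g : nat -> nat) :
  \sum_(v : Xi k) g (deg v) = k.+1 * (5 * g 2 + 2 * g 5).
Proof.
rewrite big_sumType /=.
under [X in _ + X]eq_bigr do rewrite deg_H.
rewrite (sum_tagged (fun=> g 2)) -big_distrl /= sum_hsize.
rewrite sum_pair.
under eq_bigr do under eq_bigr do rewrite deg_path fun_if.
rewrite sum_nat_const card_bool sum_odd; lia.
Qed.

Lemma gorder_Xi : gorder (Xi k) = 7 * k.+1.
Proof. by rewrite /gorder -sum1_card (sum_Xi (fun=> 1)); lia. Qed.

Lemma gsize_Xi : gsize (Xi k) = 10 * k.+1.
Proof. have := handshake (Xi k); rewrite (sum_Xi id); lia. Qed.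

Lemma M1_Xi : M1 (Xi k) = 70 * k.+1.
Proof. by rewrite /M1 (sum_Xi (fun d => d ^ 2)); lia. Qed.

Lemma M2_Xi : M2 (Xi k) = 100 * k.+1.
Proof. by rewrite (M2_const_edges deg_adj) gsize_Xi; lia. Qed.

(** By [deg_adj], both neighbours of a vertex of degree 2 have degree 5. *)
Lemma deg_nbr_Xi (u : Xi k) : deg u = 2 -> \sum_y adj u y * deg y = 10.
Proof.
move=> du; have -> : 10 = deg u * 5 by rewrite du.
rewrite degE big_distrl; apply: eq_bigr => y _.
case uy: (adj u y) => //.
by apply/eqP; rewrite !mul1n -(eqn_pmul2l (isT : 0 < 2)) -{1}du deg_adj.
Qed.

End XiInvariants.

(** * Invariants of cubic graphs *)

Section Cubic.
Variable H : sgraph.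
Hypothesis hH : regular H 3.

Lemma gsize_cubic : 2 * gsize H = 3 * gorder H.
Proof.
rewrite handshake (eq_bigr (fun=> 3)) => [|v _]; last exact: hH.
by rewrite sum_nat_const mulnC.
Qed.

Lemma M1_cubic : M1 H = 9 * gorder H.
Proof.
rewrite /M1 (eq_bigr (fun=> 9)) => [|v _]; last by rewrite hH.
by rewrite sum_nat_const mulnC.
Qed.

Lemma M2_cubic : M2 H = 9 * gsize H.
Proof. by apply: M2_const_edges => x y _; rewrite !hH. Qed.

Lemma deg_nbr_cubic (w : H) : \sum_y adj w y * deg y = 9.
Proof.
transitivity (\sum_y adj w y * 3); first by apply: eq_bigr => y _; rewrite hH.
by rewrite -big_distrl /= -degE hH.
Qed.

End Cubic.

(** * The numerical inequality and the conclusion *)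

Lemma ratio_gt (a b c d : nat) : 0 < b -> 0 < d ->
  (a%:R / b%:R > c%:R / d%:R :> rat)%R -> c * b < a * d.
Proof.
move=> b_gt0 d_gt0; rewrite Num.Theory.ltr_pdivrMr ?Num.Theory.ltr0n //.
rewrite GRing.mulrAC Num.Theory.ltr_pdivlMr ?Num.Theory.ltr0n //.
by rewrite -!GRing.natrM Num.Theory.ltr_nat.
Qed.

Lemma order_bound (K n m : nat) : 0 < K -> 2 * m = 3 * n ->
  (100 * K + 9 * m + 31) * (7 * K + n) <
    (70 * K + 9 * n + 12) * (10 * K + m + 1) ->
  218 <= 7 * K + n.
Proof.
move=> K_gt0 mn lt.
have Kmn : 2 * (K * m) = 3 * (K * n) by rewrite mulnCA mn; lia.
(* The terms in [K * K] and [n * m] cancel; doubling the rest and eliminating [m] leaves this, which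
   is the form [(K - 8) * (n - 54) > 408]. *)
have key : 54 * K + 8 * n < K * n + 24 by lia.
have K_gt8 : 8 < K.
  rewrite ltnNge; apply/negP => K_le8.
  have := leq_mul K_le8 (leqnn n); lia.
have n_gt54 : 54 < n.
  rewrite ltnNge; apply/negP => n_le54.
  (* Since [K > 8], the subtraction [K - 9] is not truncated. *)
  have := leq_mul (leqnn (K - 9)) n_le54; nia.
have [a aK] : exists a, K = a + 8 by exists (K - 8); lia.
have [b bn] : exists b, n = b + 54 by exists (n - 54); lia.
have ab : 408 < a * b by move: key; rewrite aK bn; lia.
have [agm _] := nat_AGM2 (7 * a) b.
rewrite leqNgt; apply/negP; rewrite aK bn => small.
(* An order of at most 217 = 7 * 8 + 54 + 107 means [7 * a + b <= 107]. But AM-GM gives a square of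
   at least 4 * 7 * 409 = 11452, while 107 squared is 11449. *)
have : (7 * a + b) ^ 2 <= 107 ^ 2 by rewrite leq_sqr; lia.
by move=> /(leq_trans agm); lia.
Qed.

Theorem proposition2p5 (k : nat) (hk : 0 < k)
    (H : sgraph) (hH : regular H 3)
    (u : Xi k) (hu : deg u = 2) (w : H) :
  let G := join_by_edge u w in
  ((M1 G)%:R / (gorder G)%:R > (M2 G)%:R / (gsize G)%:R :> rat)%R ->
  218 <= gorder G.
Proof.
move=> G lt; have {lt} := ratio_gt _ _ lt.
rewrite /G gorder_join gsize_join M1_join M2_join.
rewrite gorder_Xi // gsize_Xi // M1_Xi // M2_Xi // (deg_nbr_Xi hk hu).
rewrite (M1_cubic hH) (M2_cubic hH) (deg_nbr_cubic hH) hu hH.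
have := gsize_cubic hH; move: (gorder H) (gsize H) => n m mn.
(* The two premises discharged here are the positivity of the order and of the size. *)
move=> /(_ ltac:(lia) ltac:(lia)) lt; apply: (order_bound (m := m)) => //.
lia.
Qed.
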